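(* Let $q$ be a prime power, let $r\geq 2$ be an integer, and let $t$ be a positive integer with $t\mid q-1$. Let $\mathbb{F}=\mathrm{GF}(q^{r-1})$ and let $H\subseteq\mathbb{F}^\ast$ be the subgroup of the multiplicative group of order $t(q^{r-2}+\cdots+q+1)$. Let $G(q^{r-1},t(q^{r-2}+\cdots+q+1))$ be the graph whose vertex set is $(\mathbb{F}\times\mathbb{F}\setminus\{(0,0)\})/\sim$, where $(a_1,b_1)\sim(a_2,b_2)$ iff there is $h\in H$ with $a_1=ha_2$ and $b_1=hb_2$, and in which two distinct vertices $\langle a,b\rangle$ and $\langle x,y\rangle$ are adjacent iff $ax+by\in H$. Then this graph is $K_{r,t^{r-1}(r-1)!+1}$-free.
   Context: $\langle a,b\rangle$ denotes the equivalence class of $(a,b)$; adjacency is independent of representatives; the graph is simple (no loops). A graph is $K_{s,u}$-free if it contains no (not necessarily induced) subgraph isomorphic to the complete bipartite graph $K_{s,u}$. *)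

(* Defs.v *)
From HB Require Import structures.
From mathcomp Require Import all_boot all_order all_algebra.
Set Implicit Arguments. Unset Strict Implicit. Unset Printing Implicit Defensive.
Import GRing.Theory.
Local Open Scope ring_scope.

Definition prime_power (q : nat) : Prop :=
  exists p k : nat, prime p /\ (0 < k)%N /\ q = (p ^ k)%N.

Definition mult_subgroup (F : finFieldType) (H : {set F}) : Prop :=
  [/\ 0 \notin H, 1 \in H,
      (forall x y, x \in H -> y \in H -> x * y \in H) &
      (forall x, x \in H -> x^-1 \in H)].

Section Graph.
Variables (F : finFieldType) (H : {set F}).

Definition nzpairs : {set F * F} := [set u : F * F | u != (0, 0)].

Definition pequiv (u v : F * F) : bool :=
  [exists h in H, (u.1 == h * v.1) && (u.2 == h * v.2)].

Definition pclass (u : F * F) : {set F * F} := [set v in nzpairs | pequiv v u].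

Definition gvertices : {set {set F * F}} := [set pclass u | u in nzpairs].

(* adjacency: distinct classes <a,b>, <x,y> with a x + b y in H
   (independent of representatives; we quantify over representatives) *)
Definition gadj (C D : {set F * F}) : bool :=
  (C != D) && [exists u in C, exists v in D, u.1 * v.1 + u.2 * v.2 \in H].

End Graph.

(* A graph with vertex set V and adjacency e contains K_{s,u} as a (not
   necessarily induced) subgraph iff there are disjoint vertex sets A, B with
   |A| = s, |B| = u and every vertex of A adjacent to every vertex of B. *)
Definition Ksu_free (T : finType) (V : {set T}) (e : rel T) (s u : nat) : Prop :=
  ~ exists A B : {set T},
      [/\ A \subset V, B \subset V, #|A| = s, #|B| = u &
          [disjoint A & B] /\ (forall a b, a \in A -> b \in B -> e a b)].

(* Main.v *)
Require Import Defs.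
From HB Require Import structures.
From mathcomp Require Import all_boot all_order all_algebra all_field.
From mathcomp Require Import ring zify.
Set Implicit Arguments. Unset Strict Implicit. Unset Printing Implicit Defensive.
Import GRing.Theory.
Local Open Scope ring_scope.

(** Put n = r - 1. A common neighbour of r vertices <u_0>, ..., <u_n> has a
    unique representative v with u_0.v = 1, and then u_i.v = l_i + b_i s for a
    scalar s that determines v. Membership in H forces N(u_i.v)^t = 1, where
    N(z) = prod_(k < n) z^(q^k), so (N(u_i.v))_i takes at most t^n values, and it
    remains to bound by n! the number of solutions of
    prod_(k < n) (x_k - a_ik) = c_i, i < n, where the a_ik are distinct for
    fixed k (Kollar, Ronyai, Szabo).

    That bound needs no algebraic geometry: the n! monomials x^e with e_k <= k
    span all functions on the solution set. Dually, a weight w on the solutions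
    orthogonal to these monomials vanishes: the equations allow one to raise the
    degree bounds of the monomials orthogonal to w, one variable at a time, until
    all functions are reached. *)

(** * Weights orthogonal to products of polynomials of bounded degree *)

Section Annihilation.
Variables (K : fieldType) (T : finType).
Implicit Types (x y : nat -> T -> K) (w : T -> K) (d : nat -> nat).

(* [d] bounds sizes, that is, degrees plus one. *)
Definition annihilates n x w d : Prop :=
  forall p : nat -> {poly K}, (forall k, (k < n)%N -> (size (p k) <= d k)%N) ->
  \sum_s w s * \prod_(k < n) (p k).[x k s] = 0.

(** Evaluation at [a] forces the constant p(a)/(a - b); subtracting that multiple of X - b leaves a
    multiple of X - a. *)
Lemma poly_two_point_split (p : {poly K}) (a b : K) (m : nat) :
    a != b -> (size p <= m.+2)%N ->
  exists (q : {poly K}) (c : K), (size q <= m.+1)%N /\ p = q * ('X - a%:P) + c%:P * ('X - b%:P).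
Proof.
move=> neq_ab sz_p.
have nz : b - a != 0 by rewrite subr_eq0 eq_sym.
have /factor_theorem[q Dq] : root (p - (p.[a])%:P) a.
  by rewrite rootE !hornerE subrr.
pose c := p.[a] / (b - a).
exists (q + c%:P), (- c); split; last first.
  have cE : (p.[a])%:P = c%:P * (b%:P - a%:P) :> {poly K}.
    by rewrite -polyCB -polyCM divfK.
  rewrite -[p in LHS](subrK (p.[a])%:P) Dq cE polyCN; ring.
apply: leq_trans (size_polyD _ _) _; rewrite geq_max; apply/andP; split; last first.
  exact: leq_trans (size_polyC_leq1 _) _.
have [->|q0] := eqVneq q 0; first by rewrite size_poly0.
have : (size (q * ('X - a%:P))%R <= m.+2)%N.
  rewrite -Dq; apply: leq_trans (size_polyD _ _) _; rewrite geq_max sz_p.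
  by rewrite size_polyN; apply: leq_trans (size_polyC_leq1 _) _.
by rewrite size_Mmonic ?monicXsubC // size_XsubC addn2.
Qed.

(* Multiples of the products that omit one root span all polynomials of the
   given size; the induction removes the factors of the product one by one. *)
Lemma poly_linear_span (I : finType) (J : {set I}) (a : I -> K)
    (P : {poly K} -> Prop) m e :
    #|J| = m.+1 -> {in J &, injective a} ->
    (forall p q, P p -> P q -> P (p + q)) ->
    (forall j (r : {poly K}), j \in J -> (size r <= e.+1)%N ->
       P (r * \prod_(i in J :\ j) ('X - (a i)%:P))) ->
  forall p : {poly K}, (size p <= (m + e).+1)%N -> P p.
Proof.
move=> cJ inja PD Pj.
(* The product over [L] lacks [l.+1] of the factors; splitting [p] at two missing roots adds one of
   them to [L] in each term. *)
have main l : (l <= m)%N -> forall L : {set I}, L \subset J -> #|L| = (m - l)%N ->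
    forall p : {poly K}, (size p <= (l + e).+1)%N -> P (p * \prod_(i in L) ('X - (a i)%:P)).
  elim: l => [|l IHl] ltlm L sLJ cL p sz_p.
    have /cards1P[j Dj] : #|J :\: L| == 1%N.
      by rewrite cardsDS // cJ cL subn0 subSnn.
    have jJ : j \in J by have := set11 j; rewrite -Dj inE => /andP[].
    have -> : L = J :\ j by rewrite -Dj setDDr setDv set0U; apply/esym/setIidPr.
    exact: Pj.
  have : (1 < #|J :\: L|)%N by rewrite cardsDS // cJ cL; lia.
  case/card_gt1P=> i [i' [/setDP[iJ iL] /setDP[i'J i'L] neq_i]].
  have neq_a : a i != a i' by apply: contraNneq neq_i => /inja->.
  have [q [c [sz_q ->]]] := poly_two_point_split neq_a sz_p.
  have PL k (r : {poly K}) : k \in J -> k \notin L -> (size r <= (l + e).+1)%N ->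
      P (r * ('X - (a k)%:P) * \prod_(j in L) ('X - (a j)%:P)).
    move=> kJ kL sz_r; rewrite -mulrA -(big_setU1 _ kL).
    apply: (IHl (ltnW ltlm)) => //; first by rewrite subUset sub1set kJ.
    by rewrite cardsU1 kL cL; lia.
  rewrite mulrDl; apply: PD; apply: PL => //.
  exact: leq_trans (size_polyC_leq1 _) _.
move=> p sz_p; have := main m (leqnn m) set0 (sub0set J).
by rewrite cards0 subnn => /(_ erefl p sz_p); rewrite big_set0 mulr1.
Qed.

Lemma size_prod_XsubC_set (I : finType) (A : {set I}) (f : I -> K) :
  size (\prod_(i in A) ('X - (f i)%:P)) = #|A|.+1.
Proof. by rewrite -big_enum size_prod_XsubC -cardE. Qed.

(* Multiplying [w] by a polynomial in the last variable that vanishes at all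
   [a i m] but one reduces the claim to one variable and one index less. *)
Lemma annihilates_succ (I : finType) (a : I -> nat -> K) m :
  forall (J : {set I}) y w d, #|J| = m.+1 ->
    (forall k, (k < m)%N -> {in J &, injective (a^~ k)}) ->
    (forall k, (k < m)%N -> (k < d k)%N) ->
    (forall i, i \in J ->
       annihilates m y (fun s => w s * \prod_(k < m) (y k s - a i k)) d) ->
  annihilates m y w (fun k => (d k).+1).
Proof.
elim: m => [|m IHm] J y w d cJ inja ltd annJ p sz_p.
  have /cards1P[i Di] : #|J| == 1%N by rewrite cJ.
  have iJ : i \in J by rewrite Di set11.
  rewrite -[RHS](annJ i iJ p) //; apply: eq_bigr => s _.
  by rewrite !big_ord0 !mulr1.
pose P (r : {poly K}) :=
  \sum_s w s * (\prod_(k < m) (p k).[y k s] * r.[y m s]) = 0.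
suff Pm : P (p m).
  by rewrite -[RHS]Pm; apply: eq_bigr => s _; rewrite big_ord_recr.
have ltmd := ltd m (ltnSn m).
(* As [m < d m], the size bound [(m.+1 + (d m - m.+1)).+1] is exactly [(d m).+1]. *)
apply: (@poly_linear_span _ J (a^~ m) P m.+1 (d m - m.+1)%N) => //.
- exact: inja.
- move=> q r Pq Pr; rewrite /P -[RHS]addr0 -[in X in _ = X + _]Pq -[in X in _ = _ + X]Pr.
  by rewrite -big_split; apply: eq_bigr => s _; rewrite hornerD !mulrDr.
- move=> j r jJ sz_r; rewrite /P; set L := (X in r * X).
  under eq_bigr do rewrite [_ * (r * L).[_]]mulrC mulrA.
  apply: (IHm (J :\ j) y (fun s => w s * (r * L).[y m s]) d _ _ _ _ p).
  + by move: cJ; rewrite (cardsD1 j) jJ add1n => -[].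
  + move=> k ltkm i i' /setD1P[_ iJ] /setD1P[_ i'J].
    exact: (inja k (ltnW ltkm)).
  + by move=> k /ltnW; apply: ltd.
  + move=> i iJj p' sz_p'.
    have /setD1P[neq_ij iJ] := iJj.
    (* The factor of [L] at [i] extends the weight product to the variable [m]; the cofactor [q] has
       size at most [d m]. *)
    pose q := r * \prod_(i' in J :\ j :\ i) ('X - (a i' m)%:P).
    have Dq : r * L = ('X - (a i m)%:P) * q.
      by rewrite /L (big_setD1 i) //= mulrCA.
    rewrite -[RHS](annJ i iJ (fun k => if (k == m)%N then q else p' k)).
      apply: eq_bigr => s _; rewrite !big_ord_recr /= eqxx Dq.
      under [X in _ = _ * (X * _)]eq_bigr do rewrite ltn_eqF //.
      rewrite hornerM hornerXsubC; ring.
    move=> k; rewrite ltnS leq_eqVlt; case: eqVneq => [->|_] //= ltkm; last exact: sz_p'.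
    apply: leq_trans (size_polyMleq _ _) _.
    rewrite size_prod_XsubC_set.
    have : #|J| = (#|J :\ j :\ i|).+2.
      by rewrite (cardsD1 j) jJ (cardsD1 i) iJj.
    by rewrite cJ; lia.
  + by move=> k ltkm; apply: sz_p; apply: ltnW.
- by rewrite -addSn; have := sz_p m (ltnSn m); lia.
Qed.

Lemma annihilates_le n x w d d' :
    (forall k, (k < n)%N -> (d' k <= d k)%N) ->
  annihilates n x w d -> annihilates n x w d'.
Proof.
move=> led ann p sz_p; apply: ann => k ltkn.
exact: leq_trans (sz_p k ltkn) (led k ltkn).
Qed.

Lemma prod_ord_bump n (G : nat -> K) j : (j < n.+1)%N ->
  \prod_(k < n.+1) G k = G j * \prod_(k < n) G (bump j k).
Proof. by move=> ltjn; rewrite (bigD1_ord (Ordinal ltjn)). Qed.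

(** * Raising the degree bounds by means of the product equations *)

Section System.
Variables (I : finType) (a : I -> nat -> K) (b : I -> K) (x : nat -> T -> K).
Variable n : nat.
Hypothesis card_I : #|I| = n.+1.
Hypothesis a_inj : forall k, (k < n.+1)%N -> injective (a^~ k).
Hypothesis x_sol : forall s i, \prod_(k < n.+1) (x k s - a i k) = b i.

(* The equations express [x j * h i], where [h i] is the product of the factors
   with [k != j], by terms of lower degree in [x j]; the multiples of the [h i]
   exhaust the remaining variables by [annihilates_succ]. *)
Lemma annihilates_incr w d j : (j < n.+1)%N -> (0 < d j)%N ->
    (forall k, (k < n)%N -> (k.+1 < d (bump j k))%N) ->
  annihilates n.+1 x w d -> annihilates n.+1 x w (fun k => d k + (k == j))%N.
Proof.
move=> ltjn dj_gt0 ltd ann p sz_p.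
have ltbump k : (k < n)%N -> (bump j k < n.+1)%N by rewrite /bump; lia.
have neqb k : (bump j k == j) = false by apply/negbTE; rewrite eq_sym neq_bump.
(* Only the part [q * 'X] of [p j] can exceed the old bound. *)
have [q [c [Dp sz_q]]] : exists (q : {poly K}) (c : K),
    p j = q * 'X + c%:P /\ (size q <= d j)%N.
  have := sz_p j ltjn; rewrite eqxx addn1.
  elim/poly_ind: (p j) => [|q c _] sz_qc; first by exists 0, 0; rewrite mul0r addr0 size_poly0.
  exists q, c; split=> //; move: sz_qc; rewrite size_MXaddC.
  by case: ifP => [/andP[/eqP-> _]|_] //; rewrite size_poly0.
pose ext r (p' : nat -> {poly K}) (k : nat) := if k == j then r else p' (unbump j k).
have extE r p' s : \prod_(k < n.+1) (ext r p' k).[x k s] =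
    r.[x j s] * \prod_(k < n) (p' k).[x (bump j k) s].
  rewrite (prod_ord_bump (fun k => (ext r p' k).[x k s]) ltjn) /ext eqxx.
  by under eq_bigr do rewrite neqb bumpK.
have extP (r : {poly K}) (p' : nat -> {poly K}) : (size r <= d j)%N ->
    (forall k, (k < n)%N -> (size (p' k) <= d (bump j k))%N) ->
    \sum_s w s * (r.[x j s] * \prod_(k < n) (p' k).[x (bump j k) s]) = 0.
  move=> sz_r sz_p'; rewrite -[RHS](ann (ext r p')).
    by apply: eq_bigr => s _; rewrite extE.
  move=> k ltkn; rewrite /ext; case: eqVneq => [->|neqkj] //.
  have Dk : bump j (unbump j k) = k by rewrite unbumpKcond (negbTE neqkj).
  by rewrite -{2}Dk; apply: sz_p'; move: ltkn neqkj; rewrite /unbump; lia.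
have sz_pb k : (k < n)%N -> (size (p (bump j k)) <= d (bump j k))%N.
  by move=> ltkn; have := sz_p _ (ltbump k ltkn); rewrite neqb addn0.
have sumX : \sum_s w s * q.[x j s] * x j s *
    \prod_(k < n) (p (bump j k)).[x (bump j k) s] = 0.
  apply: (@annihilates_succ I (fun i k => a i (bump j k)) n setT
    (fun k => x (bump j k)) (fun s => w s * q.[x j s] * x j s)
    (fun k => (d (bump j k)).-1) _ _ _ _ (fun k => p (bump j k))).
  - by rewrite cardsT.
  - by move=> k ltkn i i' _ _; apply: a_inj; apply: ltbump.
  - by move=> k /ltd; lia.
  - move=> i _ p' sz_p'.
    have sz_p'b k : (k < n)%N -> (size (p' k) <= d (bump j k))%N.
      by move=> ltkn; apply: leq_trans (sz_p' k ltkn) (leq_pred _).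
    (* With h the product of the [x k s - a i k] for k != j, the equation reads x_j h = b_i + a_ij
       h; [E1] and [E2] kill the two terms. The lowered bound [(d _).-1] leaves room for the linear
       factors in [E2]. *)
    have E1 := extP q p' sz_q sz_p'b.
    have E2 : \sum_s w s * (q.[x j s] * \prod_(k < n)
        (('X - (a i (bump j k))%:P) * p' k).[x (bump j k) s]) = 0.
      apply: (extP q (fun k => ('X - (a i (bump j k))%:P) * p' k)) => // k ltkn.
      apply: leq_trans (size_polyMleq _ _) _.
      by rewrite size_XsubC; have := sz_p' k ltkn; have := ltd k ltkn; lia.
    have := congr2 +%R (congr1 ( *%R (b i)) E1) (congr1 ( *%R (a i j)) E2).
    rewrite !mulr0 addr0 => E12; rewrite -[RHS]E12.
    rewrite !mulr_sumr -big_split; apply: eq_bigr => s _ /=.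
    rewrite -(x_sol s i) (prod_ord_bump (fun k => x k s - a i k) ltjn).
    under [in X in _ = _ + X]eq_bigr do rewrite hornerM hornerXsubC.
    rewrite big_split /=; ring.
  - by move=> k ltkn; have := sz_pb k ltkn; have := ltd k ltkn; lia.
rewrite -[RHS]addr0 -[X in _ = X + _]sumX.
rewrite -[X in _ = _ + X](extP c%:P (fun k => p (bump j k))) //; last first.
  exact: leq_trans (size_polyC_leq1 _) _.
rewrite -big_split; apply: eq_bigr => s _ /=.
rewrite (prod_ord_bump (fun k => (p k).[x k s]) ltjn) Dp hornerD hornerM hornerX !hornerC; ring.
Qed.

(** Raising the variables to [M] in the order of their indices respects the hypothesis of
    [annihilates_incr]: while variable j is raised, the k-th of the others has bound M > n >= k + 1
    if k < j, and k + 2 otherwise. *)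
Lemma annihilates_saturate w M : (n < M)%N ->
  annihilates n.+1 x w succn -> annihilates n.+1 x w (fun=> M).
Proof.
move=> ltnM ann0.
have main j e : (j <= n)%N -> (j.+1 + e <= M)%N ->
    annihilates n.+1 x w (fun k => if k < j then M else k.+1)%N ->
    annihilates n.+1 x w
      (fun k => if k < j then M else if k == j then j.+1 + e else k.+1)%N.
  move=> lejn; elim: e => [|e IHe] leM annj.
    apply: annihilates_le annj => k _.
    by case: ifP => // _; case: eqP => [->|]; rewrite ?addn0.
  have leM' : (j.+1 + e <= M)%N by lia.
  have {IHe}/annihilates_incr-/(_ j) := IHe leM' annj.
  rewrite ltnS ltnn eqxx => /(_ lejn isT) IHe.
  apply: annihilates_le (IHe _) => [k _|k ltkn].
    by case: (ltnP k j) => _; case: eqVneq => _ /=; lia.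
  by rewrite /bump; case: (leqP j k) => ltjk; do ?case: ifP; lia.
have full j : (j <= n.+1)%N ->
    annihilates n.+1 x w (fun k => if k < j then M else k.+1)%N.
  elim: j => [|j IHj] ltjn //.
  have leM : (j.+1 + (M - j.+1) <= M)%N by lia.
  apply: annihilates_le (main j _ ltjn leM (IHj (ltnW ltjn))) => k _.
  by do ?case: ifP; lia.
by apply: annihilates_le (full _ (leqnn _)) => k ->.
Qed.

(** Testing [w] against a product that is nonzero only at [s] isolates [w s]. The size of its k-th
    factor is at most [#|T|] because [s] is not in [A k]. *)
Lemma annihilates_eq0 w (s : T) :
    (forall s1 s2, (forall k, (k < n.+1)%N -> x k s1 = x k s2) -> s1 = s2) ->
  annihilates n.+1 x w (fun=> #|T|) -> w s = 0.
Proof.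
move=> sep ann; pose A k := [set s' | x k s' != x k s].
have /ann : forall k, (k < n.+1)%N ->
    (size (\prod_(s' in A k) ('X - (x k s')%:P))%R <= #|T|)%N.
  move=> k _; rewrite size_prod_XsubC_set; apply: proper_card.
  by apply/properP; split; [apply/subsetP|exists s; rewrite // inE eqxx].
rewrite (bigD1 s) //= [X in _ + X]big1 ?addr0 => [/eqP|s' neq_s].
  rewrite mulf_eq0 => /orP[/eqP//|].
  case/prodf_eq0=> k _; rewrite horner_prod => /prodf_eq0[s'].
  by rewrite inE hornerXsubC subr_eq0 eq_sym => /negbTE->.
have /existsP[k neqk] : [exists k : 'I_n.+1, x k s' != x k s].
  apply: contraNT neq_s; rewrite negb_exists => /forallP eqx.
  by apply/eqP/sep => k ltkn; apply/eqP; rewrite -[_ == _]negbK (eqx (Ordinal ltkn)).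
rewrite (bigD1 k) //= horner_prod (bigD1 s') ?inE //=.
by rewrite hornerXsubC subrr !mul0r mulr0.
Qed.
End System.

(** * A nonzero weight on more than n! points, and the resulting bound *)

Lemma card_family_ltn n :
  #|family (fun k : 'I_n => [pred i : 'I_n | i < k.+1]%N)| = n`!.
Proof.
rewrite -sum1_card.
transitivity (\sum_(f in family (fun k : 'I_n => [pred i : 'I_n | i < k.+1]%N))
    \prod_(k : 'I_n) 1)%N.
  by apply: eq_bigr => f _; rewrite big1.
rewrite -(bigA_distr_big_dep _ (fun _ _ => 1%N)) fact_prod big_add1 big_mkord /=.
by apply: eq_bigr => k _; rewrite /= -(big_ord_widen n (fun=> 1%N)) // sum1_card card_ord.
Qed.

(** Orthogonality to the n! monomials is a homogeneous linear system with more unknowns than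
    equations. *)
Lemma exists_annihilator n x : (n`! < #|T|)%N ->
  exists2 w, (exists s, w s != 0) & annihilates n x w succn.
Proof.
rewrite -card_family_ltn; set D := family _ => ltDT.
pose M := \matrix_(s < #|T|, f < #|D|) \prod_(k < n) x k (enum_val s) ^+ (enum_val f k).
have /rowV0Pn[v] : kermx M != 0.
  by rewrite kermx_eq0 /row_free neq_ltn (leq_ltn_trans (rank_leq_col _)).
rewrite sub_kermx => /eqP vM0 /rV0Pn[i vi0].
exists (fun s => v 0 (enum_rank s)).
  by exists (enum_val i); rewrite enum_valK.
have vf f : f \in D -> \sum_s v 0 (enum_rank s) * \prod_(k < n) x k s ^+ f k = 0.
  move=> fD; have := congr1 (fun A : 'rV_#|D| => A 0 (enum_rank_in fD f)) vM0.
  rewrite !mxE => vMf; rewrite -[RHS]vMf [LHS](reindex (@enum_val T T)) /=; last first.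
    exact/onW_bij/enum_val_bij.
  by apply: eq_bigr => s _; rewrite enum_valK !mxE enum_rankK_in.
move=> p sz_p.
transitivity (\sum_(f in D) (\prod_(k < n) (p k)`_(f k)) *
    \sum_s v 0 (enum_rank s) * \prod_(k < n) x k s ^+ f k); last first.
  by apply: big1 => f fD; rewrite vf // mulr0.
under [RHS]eq_bigr do rewrite mulr_sumr.
rewrite exchange_big; apply: eq_bigr => s _ /=.
under [RHS]eq_bigr do rewrite mulrCA -big_split.
rewrite -mulr_sumr -(bigA_distr_big_dep _ (fun k i : 'I_n => (p k)`_i * x k s ^+ i)).
congr (_ * _); apply: eq_bigr => k _.
by rewrite (horner_coef_wide _ (sz_p k (ltn_ord k))) 
  (big_ord_widen n (fun i => (p k)`_i * x k s ^+ i)).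
Qed.

End Annihilation.

Lemma card_product_system (K : fieldType) (T I : finType) n
    (a : I -> nat -> K) (b : I -> K) (x : nat -> T -> K) (S : {set T}) :
    (0 < n)%N -> #|I| = n -> (forall k, (k < n)%N -> injective (a^~ k)) ->
    (forall s i, s \in S -> \prod_(k < n) (x k s - a i k) = b i) ->
    {in S &, forall s1 s2, (forall k, (k < n)%N -> x k s1 = x k s2) -> s1 = s2} ->
  (#|S| <= n`!)%N.
Proof.
case: n => // n _ cI a_inj x_sol sep.
have -> : #|S| = #|{: {s | s \in S}}| by rewrite card_sig; apply: eq_card.
rewrite leqNgt; apply/negP.
pose y k (s : {s | s \in S}) := x k (val s).
case/(exists_annihilator y)=> w [s ws0] ann.
have y_sol s' i : \prod_(k < n.+1) (y k s' - a i k) = b i.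
  exact: x_sol (valP s').
pose m := #|{: {s | s \in S}}|.
(* Saturation needs a bound above [n], and [annihilates_eq0] needs one of at least the number of
   points. *)
have annM := annihilates_saturate cI a_inj y_sol (leq_maxl n.+1 m) ann.
case/eqP: ws0; apply: (@annihilates_eq0 _ _ y n).
  by move=> s1 s2 eqx; apply/val_inj/sep => //; apply: valP.
by apply: annihilates_le annM => k _; apply: leq_maxr.
Qed.

(** * Linear forms on the plane and norm equations *)

Definition dotp (R : comNzRingType) (u v : R * R) : R := u.1 * v.1 + u.2 * v.2.
Definition det2 (R : comNzRingType) (u v : R * R) : R := u.1 * v.2 - u.2 * v.1.

Lemma dotpZr (R : comNzRingType) (k : R) (u v : R * R) :
  dotp u (k * v.1, k * v.2) = k * dotp u v.
Proof. by rewrite /dotp /=; ring. Qed.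

Lemma card_unity_roots (F : finFieldType) t : (0 < t)%N ->
  (#|[set z : F | z ^+ t == 1%R]| <= t)%N.
Proof.
move=> t_gt0; rewrite cardE; apply: max_unity_roots (enum_uniq _) => //.
by apply/allP=> z; rewrite mem_enum inE unity_rootE.
Qed.

Section NormSystem.
Variables (F : finFieldType) (q n t : nat).
Hypothesis pchar_q : [pchar F].-nat q.

Lemma expfD_pchar_pow k (x y : F) :
  (x + y) ^+ (q ^ k) = x ^+ (q ^ k) + y ^+ (q ^ k).
Proof. by apply: exprDn_pchar; rewrite pnatX pchar_q. Qed.

Lemma expf_pchar_pow_inj k : injective (fun x : F => x ^+ (q ^ k)).
Proof.
move=> x y /= eqxy; apply/eqP; rewrite -subr_eq0.
have : (x - y) ^+ (q ^ k) == 0.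
  by rewrite -(inj_eq (addIr (y ^+ (q ^ k)))) -expfD_pchar_pow subrK add0r eqxy.
by rewrite expf_eq0 => /andP[].
Qed.

Hypotheses (n_gt0 : (0 < n)%N) (t_gt0 : (0 < t)%N).
Variables (u0 : F * F) (u : 'I_n -> F * F).
Hypothesis u0_free : forall i, det2 u0 (u i) != 0.
Hypothesis u_free : forall i j, i != j -> det2 (u i) (u j) != 0.

(** If F has q^n elements, z^e is the norm of z to the subfield of order q. *)
Let e := (\sum_(k < n) q ^ k)%N.

(** On the line u0.v = 1 each u_i.v is affine in w.v, and additivity of Frobenius powers turns its
    e-th power into a product of factors linear in the (w.v)^(q^k). *)
Lemma card_norm_system (c : 'I_n -> F) :
  (#|[set v | (dotp u0 v == 1%R) && [forall i, dotp (u i) v ^+ e == c i]]| <= n`!)%N.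
Proof.
have [w w1] : exists w, det2 u0 w = 1.
  have := u0_free (Ordinal n_gt0); set d := det2 _ _ => nzd.
  exists ((u (Ordinal n_gt0)).1 / d, (u (Ordinal n_gt0)).2 / d).
  by rewrite -[RHS](divff nzd) /d /det2 /=; ring.
(* In the basis [u0], [w], the vector [u i] has coordinates [det2 (u i) w] and [det2 u0 (u i)]. *)
pose g i := det2 (u i) w / det2 u0 (u i).
have dotE i v : dotp u0 v = 1 -> dotp (u i) v = det2 u0 (u i) * (dotp w v + g i).
  move=> v1; rewrite mulrDr /g mulrCA divff // mulr1.
  by rewrite -[LHS]mul1r -w1 -[X in _ + X]mulr1 -v1 /dotp /det2; ring.
have g_inj : injective g.
  move=> i j eqg; apply/eqP; apply: contraT => /u_free/negP[].
  (* The difference of the two sides is [det2 (u i) (u j)] times [det2 u0 w], which is 1. *)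
  have : det2 (u i) w * det2 u0 (u j) = det2 (u j) w * det2 u0 (u i).
    by apply/eqP; rewrite -eqr_div ?u0_free //; apply/eqP.
  move/eqP; rewrite -subr_eq0 => /eqP eq0; apply/eqP.
  by rewrite -[LHS]mulr1 -w1 -[RHS]eq0 /det2; ring.
pose a i k := - g i ^+ (q ^ k).
pose x k v := dotp w v ^+ (q ^ k).
apply: (@card_product_system F _ _ n a (fun i => c i / det2 u0 (u i) ^+ e) x).
- exact: n_gt0.
- exact: card_ord.
- by move=> k _ i j /oppr_inj/expf_pchar_pow_inj/g_inj.
- move=> v i; rewrite inE => /andP[/eqP v1 /forallP/(_ i)/eqP <-].
  rewrite dotE // exprMn mulrAC divff ?expf_neq0 // mul1r /e -prodrXr.
  by apply: eq_bigr => k _; rewrite /a opprK -expfD_pchar_pow.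
- move=> v v'; rewrite !inE => /andP[/eqP v1 _] /andP[/eqP v1' _].
  (* For k = 0 the unknown is [dotp w v] itself, and [v] is recovered from its products with [u0]
     and [w] by Cramer's rule. *)
  move=> /(_ 0 n_gt0); rewrite /x !expr1 => eqw.
  have E1 : dotp u0 v = dotp u0 v' by rewrite v1.
  have coordE z : z = (w.2 * dotp u0 z - u0.2 * dotp w z,
                       u0.1 * dotp w z - w.1 * dotp u0 z).
    rewrite [LHS]surjective_pairing -[z.1]mul1r -[z.2]mul1r -w1 /dotp /det2.
    by congr pair; ring.
  by rewrite (coordE v) (coordE v') v1 v1' eqw.
Qed.

(** The e-th powers form a vector of n roots of unity of order dividing t, hence at most t^n
    vectors, each giving one system of [card_norm_system]. *)
Lemma card_unity_norm_system :
  (#|[set v | (dotp u0 v == 1%R) && [forall i, (dotp (u i) v ^+ e) ^+ t == 1%R]]|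
     <= t ^ n * n`!)%N.
Proof.
set S := [set v | _].
pose Z := [set z : F | z ^+ t == 1].
pose phi v := [ffun i => dotp (u i) v ^+ e].
rewrite -sum1_card (partition_big phi (mem (ffun_on Z))) /=; last first.
  move=> v; rewrite inE => /andP[_ /forallP vt].
  by apply/ffun_onP=> i; rewrite ffunE inE.
apply: (@leq_trans (\sum_(c in ffun_on Z) n`!)%N).
  apply: leq_sum => c _; rewrite sum1_card.
  apply: leq_trans (card_norm_system c); apply/subset_leq_card/subsetP => v.
  case/andP; rewrite !inE => /andP[-> _] /eqP <-.
  by apply/forallP=> i; rewrite ffunE.
rewrite sum_nat_const card_ffun_on card_ord leq_mul2r.
by rewrite leq_exp2r // card_unity_roots // orbT.
Qed.
End NormSystem.

(** * Vertex classes, adjacency and common neighbours *)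

Section Graph.
Variables (F : finFieldType) (H : {set F}).
Hypothesis H_subgroup : mult_subgroup H.
Implicit Types (u v : F * F) (C D : {set F * F}).

Lemma mult_subgroup_neq0 h : h \in H -> h != 0.
Proof. by case: H_subgroup => H0 _ _ _; apply: contraTneq => ->. Qed.

(** Multiplication by [h] permutes [H], so it preserves the product of all elements of [H], which is
    nonzero. *)
Lemma mult_subgroup_expf_card h : h \in H -> h ^+ #|H| = 1.
Proof.
move=> hH; have [_ _ HM HV] := H_subgroup; have h0 := mult_subgroup_neq0 hH.
have nz : \prod_(z in H) z != 0 by apply/prodf_neq0 => z /mult_subgroup_neq0.
apply: (mulIf nz); rewrite mul1r -prodr_const -big_split /=.
rewrite [RHS](reindex_onto ( *%R h) ( *%R h^-1)) /=; last first.
  by move=> z _; rewrite mulVKf.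
apply: eq_bigl => z; rewrite mulKf // eqxx andbT.
apply/idP/idP => [|hzH]; first exact: HM.
by rewrite -(mulKf h0 z); apply: HM => //; apply: HV.
Qed.

Lemma pequivP u v :
  reflect (exists2 h, h \in H & u = (h * v.1, h * v.2)) (pequiv H u v).
Proof.
apply: (iffP existsP) => [[h /andP[hH /andP[/eqP e1 /eqP e2]]]|[h hH ->]].
  by exists h; rewrite // -e1 -e2 -surjective_pairing.
by exists h; rewrite hH !eqxx.
Qed.

Lemma pclass_scale h v : h \in H -> pclass H (h * v.1, h * v.2) = pclass H v.
Proof.
move=> hH; have [_ _ HM HV] := H_subgroup.
apply/setP=> z; rewrite !inE; congr (_ && _).
apply/pequivP/pequivP => [] [k kH ->] /=.
  by exists (k * h); rewrite ?HM // !mulrA.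
by exists (k / h); rewrite ?HM ?HV // !mulrA divfK ?mult_subgroup_neq0.
Qed.

Lemma gvertexE C u : C \in gvertices H -> u \in C -> C = pclass H u.
Proof.
case/imsetP=> v _ ->; rewrite inE => /andP[_ /pequivP[h hH ->]].
by rewrite pclass_scale.
Qed.

Lemma gvertex_scale C u h :
  C \in gvertices H -> u \in C -> h \in H -> (h * u.1, h * u.2) \in C.
Proof.
move=> CV uC hH; rewrite (gvertexE CV uC) inE; apply/andP; split; last first.
  by apply/pequivP; exists h.
have : u \in nzpairs F by have := uC; rewrite {1}(gvertexE CV uC) inE => /andP[].
rewrite !inE; apply: contraNneq => -[/eqP + /eqP].
rewrite !mulf_eq0 (negbTE (mult_subgroup_neq0 hH)) /= => /eqP e1 /eqP e2.
by rewrite [u]surjective_pairing e1 e2.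
Qed.

Lemma gvertex_rep C : C \in gvertices H -> exists u, u \in C.
Proof.
have [_ H1 _ _] := H_subgroup.
case/imsetP=> u uV ->; exists u; rewrite inE uV; apply/pequivP.
by exists 1; rewrite // !mul1r -surjective_pairing.
Qed.

(** A change of representatives multiplies the product by an element of [H], so the existential
    choice in [gadj] is harmless. *)
Lemma gadj_dotp C D u v : C \in gvertices H -> D \in gvertices H ->
  gadj H C D -> u \in C -> v \in D -> dotp u v \in H.
Proof.
have [_ _ HM HV] := H_subgroup.
move=> CV DV /andP[_ /existsP[u' /andP[u'C /existsP[v' /andP[v'D uvH]]]]] uC vD.
move: uC vD; rewrite (gvertexE CV u'C) (gvertexE DV v'D) !inE.
move=> /andP[_ /pequivP[h hH ->]] /andP[_ /pequivP[k kH ->]].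
rewrite (_ : dotp _ _ = h * k * (u'.1 * v'.1 + u'.2 * v'.2)) ?HM //.
by rewrite /dotp /=; ring.
Qed.

(* If u and u' are proportional, the ratio is that of their products with a
   common neighbour, hence lies in H. *)
Lemma common_neighbour_det2_neq0 C C' D u u' :
    C \in gvertices H -> C' \in gvertices H -> D \in gvertices H ->
    gadj H C D -> gadj H C' D -> u \in C -> u' \in C' -> C != C' ->
  det2 u u' != 0.
Proof.
have [_ _ HM HV] := H_subgroup.
move=> CV C'V DV CD C'D uC u'C'; apply: contraNneq => det0.
have [v vD] := gvertex_rep DV.
have hH := gadj_dotp CV DV CD uC vD; have h'H := gadj_dotp C'V DV C'D u'C' vD.
rewrite (gvertexE CV uC) (gvertexE C'V u'C').
rewrite -(pclass_scale u' (HM _ _ hH (HV _ h'H))).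
have nz := mult_subgroup_neq0 h'H.
apply/eqP; congr (pclass H _); rewrite [LHS]surjective_pairing.
have E1 : u.1 * dotp u' v = dotp u v * u'.1.
  apply/eqP; rewrite -subr_eq0 -(mulr0 v.2) -det0 /dotp /det2; apply/eqP; ring.
have E2 : u.2 * dotp u' v = dotp u v * u'.2.
  apply/eqP; rewrite -subr_eq0 -(mulr0 (- v.1)) -det0 /dotp /det2; apply/eqP; ring.
by congr pair; rewrite mulrAC -?E1 -?E2 mulfK.
Qed.
End Graph.

Theorem theorem8 (q r t : nat) (F : finFieldType) (H : {set F}) :
  prime_power q -> (2 <= r)%N -> (0 < t)%N -> (t %| q - 1)%N ->
  #|F| = (q ^ (r - 1))%N ->
  mult_subgroup H ->
  #|H| = (t * \sum_(i < r - 1) q ^ i)%N ->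
  Ksu_free (gvertices H) (@gadj F H) r (t ^ (r - 1) * (r - 1)`! + 1)%N.
Proof.
move=> [p [k [p_pr [_ Dq]]]] r_ge2 t_gt0 _ cF subH cH [A [B [sAV sBV cA cB [_ adj]]]].
have pchar_q : [pchar F].-nat q.
  have pF : p \in [pchar F].
    by apply: (@card_finPcharP _ p (k * (r - 1))) => //; rewrite expnM -Dq.
  by rewrite Dq pnatX pnatE ?pF.
have AV C : C \in A -> C \in gvertices H by apply/subsetP.
have BV D : D \in B -> D \in gvertices H by apply/subsetP.
have [C0 C0A] : exists C, C \in A by apply/set0Pn; rewrite -card_gt0 cA; lia.
have [D0 D0B] : exists D, D \in B by apply/set0Pn; rewrite -card_gt0 cB; lia.
(* [C0] supplies the normalisation u_0.v = 1, and the other r - 1 vertices of [A] supply the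
   equations. *)
have Dr : (r - 1)%N = #|A :\ C0| by rewrite -cA (cardsD1 C0) C0A addKn.
rewrite {}Dr in cF cH cB *.
set n := #|A :\ C0| in cF cH cB *.
have n_gt0 : (0 < n)%N by move: r_ge2; rewrite -cA (cardsD1 C0) C0A.
pose rep (C : {set F * F}) : F * F := odflt (0, 0) [pick u in C].
have repP C : C \in gvertices H -> rep C \in C.
  move=> CV; have [u uC] := gvertex_rep subH CV.
  by rewrite /rep; case: pickP => [//|/(_ u)]; rewrite uC.
pose c (i : 'I_n) : {set F * F} := enum_val i.
have cA' i : c i \in A :\ C0 by apply: enum_valP.
have cAi i : c i \in A by have /setD1P[] := cA' i.
pose u i := rep (c i).
have free C C' : C \in A -> C' \in A -> C != C' -> det2 (rep C) (rep C') != 0.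
  move=> CA C'A; apply: (common_neighbour_det2_neq0 subH _ _ (BV _ D0B)) => //;
    by rewrite ?adj ?repP ?AV.
have u0_free i : det2 (rep C0) (u i) != 0.
  by apply: free => //; have /setD1P[] := cA' i; rewrite eq_sym.
have u_free i j : i != j -> det2 (u i) (u j) != 0.
  by move=> neq_ij; apply: free => //; rewrite /c (inj_eq enum_val_inj).
have := card_unity_norm_system pchar_q n_gt0 t_gt0 u0_free u_free.
set S := [set v | _] => leS.
have pickB D : D \in B -> exists2 v, v \in D & v \in S.
  move=> DB; have [v vD] := gvertex_rep subH (BV D DB).
  have dotH C z : C \in A -> z \in D -> dotp (rep C) z \in H.
    by move=> CA zD; apply: (gadj_dotp subH (AV C CA) (BV D DB)) => //; rewrite ?adj ?repP ?AV.
  have hH := dotH C0 v C0A vD; set h := dotp _ v in hH.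
  have [_ _ _ HV] := subH.
  (* Dividing by [h], an element of [H], normalises the product with [rep C0] to 1 without leaving
     the class [D]. *)
  have hvD := gvertex_scale subH (BV D DB) vD (HV _ hH).
  exists (h^-1 * v.1, h^-1 * v.2) => //; rewrite inE; apply/andP; split.
    by rewrite dotpZr mulVf // (mult_subgroup_neq0 subH hH).
  (* The order of [H] is t e, so the t-th power of z^e is 1 on [H]. *)
  apply/forallP=> i; rewrite -exprM mulnC -cH.
  by apply/eqP/mult_subgroup_expf_card => //; apply: dotH.
pose repB (D : {set F * F}) : F * F := odflt (0, 0) [pick v in D | v \in S].
have repBP D : D \in B -> repB D \in D /\ repB D \in S.
  move=> /pickB[v vD vS]; rewrite /repB; case: pickP => [z /andP[]//|/(_ v)].
  by rewrite vD vS.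
(* A vertex is the class of any of its members, so a shared representative forces equal vertices. *)
have repB_inj : {in B &, injective repB}.
  move=> D D' DB D'B eqD; have [vD _] := repBP D DB; have [vD' _] := repBP D' D'B.
  by rewrite (gvertexE subH (BV D DB) vD) (gvertexE subH (BV D' D'B) vD') eqD.
have : (#|B| <= #|S|)%N.
  rewrite -(card_in_imset repB_inj); apply/subset_leq_card/subsetP=> _ /imsetP[D DB ->].
  by have [] := repBP D DB.
by rewrite cB; move/leq_trans/(_ leS); rewrite addn1 ltnn.
Qed.
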